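(* Let $f:\mathbb{R}^d\to\mathbb{R}$ be convex, differentiable, and $L$-smooth (with respect to $\|\cdot\|_2$), for $L>0$. Let $\theta_0\in\mathbb{R}^d$ and consider the gradient descent iterates $\theta_{t+1}=\theta_t-\eta_t\nabla f(\theta_t)$ with step sizes $\eta_t\in(0,1/L]$, $t=0,1,2,\dots$. Then for any reference point $z\in\mathbb{R}^d$ and any iteration $T\ge 1$, $$f(\theta_T)-f(z)\le \frac{1}{2\sum_{t=0}^{T-1}\eta_t}\Big(\|\theta_0-z\|_2^2-\|\theta_T-z\|_2^2\Big).$$ In particular, for a constant step size $\eta_t=\eta$, $t=0,1,2,\dots$, $$f(\theta_T)-f(z)\le\frac{1}{2\eta T}\Big(\|\theta_0-z\|_2^2-\|\theta_T-z\|_2^2\Big).$$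
   Context: A differentiable function $f$ is $L$-smooth with respect to $\|\cdot\|_2$ if $\|\nabla f(x)-\nabla f(y)\|_2\le L\|x-y\|_2$ for all $x,y$. *)

(* Defs.v *)
From HB Require Import structures.
From mathcomp Require Import all_boot all_order all_algebra.
From mathcomp Require Import all_classical all_reals all_analysis.
Set Implicit Arguments.
Unset Strict Implicit.
Unset Printing Implicit Defensive.
Import Order.TTheory GRing.Theory Num.Theory.
Import numFieldNormedType.Exports.
Local Open Scope ring_scope.

(* The canonical norm `|x| on 'rV[R]_d is the sup norm, hence this separate
   Euclidean norm. *)
Definition norm2 (R : realType) (d : nat) (x : 'rV[R]_d) : R :=
  Num.sqrt (\sum_(i < d) x ord0 i ^+ 2).

(* The row of partial derivatives. It is the gradient only where f is
   differentiable; elsewhere its entries may be junk values. *)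
Definition gradient (R : realType) (d : nat) (f : 'rV[R]_d -> R)
    (x : 'rV[R]_d) : 'rV[R]_d :=
  \row_(i < d) 'D_(delta_mx ord0 i : 'rV[R]_d) f x.

(* [differentiable] refers to the sup norm on 'rV[R]_d; since all norms on R^d
   are equivalent, it is the usual Frechet differentiability. *)
Definition smooth (R : realType) (d : nat) (L : R) (f : 'rV[R]_d -> R) : Prop :=
  (forall x : 'rV[R]_d, differentiable f x) /\
  (forall x y : 'rV[R]_d,
     norm2 (gradient f x - gradient f y) <= L * norm2 (x - y)).

(* Main.v *)
Require Import Defs.
From HB Require Import structures.
From mathcomp Require Import all_boot all_order all_algebra.
From mathcomp Require Import all_classical all_reals all_analysis.
From mathcomp Require Import ring lra.
Set Implicit Arguments.
Unset Strict Implicit.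
Unset Printing Implicit Defensive.
Import Order.TTheory GRing.Theory Num.Theory.
Import numFieldNormedType.Exports.
Local Open Scope classical_set_scope.
Local Open Scope ring_scope.

(** Two facts about f drive the proof: its graph lies above its tangent plane
    at x (convexity, [convex_tangent_le]), and lies below the paraboloid
    obtained by adding L/2 |y - x|^2 to that tangent plane (smoothness,
    [descent_lemma]).

    Take one step x' = x - eta g, where g is the gradient at x and eta <= 1/L.
    The paraboloid gives f x' <= f x - eta/2 |g|^2, so f decreases along the
    iterates. The tangent plane gives f x <= f z + <g, x - z>. Adding the two
    and completing the square,
      2 eta (f x' - f z) <= 2 eta <g, x - z> - eta^2 |g|^2
                          = |x - z|^2 - |x' - z|^2,
    a bound which telescopes. Since f decreases along the iterates, each
    f (theta (t+1)) in the telescoped sum is at least f (theta T), whence the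
    theorem. *)

(** * The Euclidean inner product *)

Definition dot (R : realType) (d : nat) (u v : 'rV[R]_d) : R :=
  \sum_(i < d) u ord0 i * v ord0 i.

Section InnerProduct.
Context (R : realType) (d : nat).
Implicit Types (u v x y z : 'rV[R]_d) (a c : R).

Lemma dotC u v : dot u v = dot v u.
Proof. by apply: eq_bigr => i _; rewrite mulrC. Qed.

Lemma dotBl u v w : dot (u - v) w = dot u w - dot v w.
Proof.
by rewrite /dot -sumrB; apply: eq_bigr => i _; rewrite !mxE mulrBl.
Qed.

Lemma dotZl a u v : dot (a *: u) v = a * dot u v.
Proof.
by rewrite /dot big_distrr/=; apply: eq_bigr => i _; rewrite mxE mulrA.
Qed.

Lemma dotBr u v w : dot u (v - w) = dot u v - dot u w.
Proof. by rewrite dotC dotBl !(dotC u). Qed.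

Lemma dotZr a u v : dot u (a *: v) = a * dot u v.
Proof. by rewrite dotC dotZl dotC. Qed.

Lemma dotvv_ge0 u : 0 <= dot u u.
Proof. by apply: sumr_ge0 => i _; rewrite -expr2 sqr_ge0. Qed.

Lemma norm2_sqr u : norm2 u ^+ 2 = dot u u.
Proof.
have e : \sum_(i < d) u ord0 i ^+ 2 = dot u u.
  by apply: eq_bigr => i _; rewrite expr2.
by rewrite /norm2 e sqr_sqrtr// dotvv_ge0.
Qed.

Lemma norm2_ge0 u : 0 <= norm2 u.
Proof. exact: sqrtr_ge0. Qed.

(** This is how Cauchy-Schwarz is used against a Lipschitz bound; expanding
    |u - c v|^2 >= 0 yields it at once. *)
Lemma dot_le_norm2 u v c :
  0 < c -> norm2 u <= c * norm2 v -> dot u v <= c * norm2 v ^+ 2.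
Proof.
move=> c0 uv.
have uv2 : dot u u <= c ^+ 2 * dot v v.
  by rewrite -!norm2_sqr -exprMn lerXn2r// nnegrE ?mulr_ge0 ?norm2_ge0// ltW.
have := dotvv_ge0 (u - c *: v).
rewrite dotBl !dotBr !dotZl !dotZr (dotC v u) norm2_sqr => sq.
rewrite -(ler_pM2l c0); nra.
Qed.

Lemma norm2_step_sqr x g z a :
  norm2 (x - a *: g - z) ^+ 2 =
  norm2 (x - z) ^+ 2 - 2 * a * dot g (x - z) + a ^+ 2 * norm2 g ^+ 2.
Proof.
rewrite !norm2_sqr addrAC; move: (x - z) => w.
rewrite dotBl !dotBr !dotZl !dotZr (dotC w g); ring.
Qed.

End InnerProduct.

(** * Restriction of a differentiable function to a line *)

Section Lines.
Context (R : realType) (d : nat).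
Implicit Types (f : 'rV[R]_d -> R) (x v : 'rV[R]_d).

(** A differentiable f has a linear differential, so its directional
    derivatives are determined by the partial derivatives. *)
Lemma derive_dot f x v :
  differentiable f x -> 'D_v f x = dot (gradient f x) v.
Proof.
move=> fx; rewrite deriveE// {1}(row_sum_delta v) linear_sum/=.
by apply: eq_bigr => i _; rewrite linearZ/= mxE deriveE// mulrC.
Qed.

Lemma is_derive_line f x v (t : R) : differentiable f (t *: v + x) ->
  is_derive t 1 (fun s : R => f (s *: v + x))
    (dot (gradient f (t *: v + x)) v).
Proof.
move=> fx.
(* Both derivatives are limits of the same difference quotient. *)
have e : (fun h : R => h^-1 *:
      (((fun s : R => f (s *: v + x)) \o shift t) (h *: 1) - f (t *: v + x)))
    = (fun h : R => h^-1 *: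
      ((f \o shift (t *: v + x)) (h *: v) - f (t *: v + x))).
  by apply/funext => h /=; rewrite [h%:A]mulr1 scalerDl addrA.
split; first by rewrite /derivable e; exact: diff_derivable.
by rewrite -derive_dot// /derive e.
Qed.

End Lines.

(** * The tangent plane and the paraboloid above it *)

Section Bounds.
Context (R : realType) (d : nat) (f : 'rV[R]_d -> R).
Implicit Types x y z : 'rV[R]_d.

(** By convexity the slopes of f from x towards y are at most the chord slope
    f y - f x; the inner product is their limit as the step tends to 0 from
    the right. *)
Lemma convex_tangent_le x y :
  convex_function [set: convex_lmodType 'rV[R]_d] f -> differentiable f x ->
  f x + dot (gradient f x) (y - x) <= f y.
Proof.
move=> cf fx; rewrite -lerBrDl -derive_dot//.
have dv : derivable f x (y - x) by exact: diff_derivable.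
apply: (cvgr_to_le (cvg_dnbhs_at_right dv)).
near=> h.
have h0 : 0 < h by near: h; exact: nbhs_right_gt.
have h1 : h <= 1 by near: h; apply: nbhs_right_le.
have := cf (Itv01 (ltW h0) h1) y x (in_setT _) (in_setT _).
rewrite convRE [h in f h]/conv/= /unstable.onem => cfh.
have e : h *: (y - x) + x = h *: y + (1 - h) *: x.
  by rewrite scalerBr scalerBl scale1r addrAC addrA.
rewrite e ler_pdivrMl//; lra.
Unshelve. all: by end_near. Qed.

(** The mean value theorem, applied on [0, 1] to the function of t that
    subtracts the claimed bound at x + t (y - x) from f; the Lipschitz gradient
    makes its derivative nonpositive. *)
Lemma descent_lemma (L : R) x y : 0 < L -> smooth L f ->
  f y <= f x + dot (gradient f x) (y - x) + L / 2 * norm2 (y - x) ^+ 2.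
Proof.
move=> L0 [df lf]; set v : 'rV[R]_d := y - x; set g := gradient f x.
pose a := dot g v; pose b := L / 2 * norm2 v ^+ 2.
pose psi := fun t : R => f (t *: v + x) - (a * t + b * t ^+ 2).
pose dpsi := fun t : R => dot (gradient f (t *: v + x)) v - (a + b * (2 * t)).
have dpsiP (t : R) : is_derive t 1 psi (dpsi t).
  have ? := is_derive_line (df (t *: v + x)).
  by apply: is_derive_eq; rewrite /dpsi ![_%:A]mulr1 mulr_natl.
have [|s /[!in_itv]/= /andP[s0 s1]] := @MVT R psi dpsi 0 1 ltr01.
  by apply: derivable_within_continuous => t _; case: (dpsiP t).
rewrite /psi scale1r scale0r add0r subrK.
have : dot (gradient f (s *: v + x) - g) v <= L * s * norm2 v ^+ 2.
  apply: dot_le_norm2; first exact: mulr_gt0.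
  apply: le_trans (lf _ _) _.
  rewrite addrK -mulrA ler_pM2l//.
  rewrite -(@ler_pXn2r _ 2)// ?nnegrE ?mulr_ge0 ?norm2_ge0// ?(ltW s0)//.
  by rewrite exprMn !norm2_sqr dotZl dotZr expr2 mulrA.
rewrite dotBl /dpsi -/a /b; lra.
Qed.

End Bounds.

(** * Gradient descent *)

Section GradientDescent.
Context (R : realType) (d : nat) (f : 'rV[R]_d -> R) (L : R).
Context (L_gt0 : 0 < L).
Implicit Types x z : 'rV[R]_d.

(** The bound eta <= 1/L makes the quadratic term of the paraboloid cost at most
    half of the first-order gain eta |g|^2. *)
Lemma gradient_step_decrease (eta : R) x : 0 < eta <= 1 / L -> smooth L f ->
  f (x - eta *: gradient f x) <= f x - eta / 2 * norm2 (gradient f x) ^+ 2.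
Proof.
move=> /andP[eta0 etaL] fs; set g := gradient f x.
have := descent_lemma x (x - eta *: g) L_gt0 fs.
rewrite [_ - _ - x]addrAC subrr sub0r -scaleNr -/g !norm2_sqr.
rewrite !dotZr dotZl => fle.
have Le : L * eta <= 1 by rewrite -ler_pdivlMl// mulrC.
have : (1 - L * eta) * (eta * dot g g) >= 0.
  by rewrite mulr_ge0 ?subr_ge0// mulr_ge0 ?dotvv_ge0// ltW.
lra.
Qed.

(** The decrease of f over the step, added to the tangent plane inequality from
    x to z, leaves exactly the terms of the expansion of the squared distance
    from the new point to z. *)
Lemma gradient_step_bound (eta : R) x z : 0 < eta <= 1 / L ->
  convex_function [set: convex_lmodType 'rV[R]_d] f -> smooth L f ->
  2 * eta * (f (x - eta *: gradient f x) - f z) <=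
  norm2 (x - z) ^+ 2 - norm2 (x - eta *: gradient f x - z) ^+ 2.
Proof.
move=> etaP cf fs.
have := gradient_step_decrease x etaP fs.
have := convex_tangent_le z cf (fs.1 x).
rewrite norm2_step_sqr; set g := gradient f x; set fx' := f (x - eta *: g).
have eta0 : 0 < eta by case/andP: etaP.
rewrite -[z - x]opprB -scaleN1r dotZr => h1 h2.
suff : eta * (fx' - f z) <= eta * (dot g (x - z) - eta / 2 * norm2 g ^+ 2).
  lra.
rewrite ler_pM2l//; lra.
Qed.

Context (theta : nat -> 'rV[R]_d) (eta : nat -> R).
Context
  (f_convex : convex_function [set: convex_lmodType 'rV[R]_d] f)
  (f_smooth : smooth L f)
  (eta_bound : forall t, 0 < eta t <= 1 / L)
  (theta_step :
    forall t, theta t.+1 = theta t - eta t *: gradient f (theta t)).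

(** In the induction step the weight already accumulated multiplies
    f (theta T) - f z, which is at least f (theta (T+1)) - f z. *)
Lemma gradient_descent_telescope z (T : nat) :
  2 * (\sum_(0 <= t < T) eta t) * (f (theta T) - f z) <=
  norm2 (theta 0%N - z) ^+ 2 - norm2 (theta T - z) ^+ 2.
Proof.
elim: T => [|T IH]; first by rewrite big_nil mulr0 mul0r subrr.
rewrite big_nat_recr//=; set S := \sum_(0 <= t < T) eta t in IH *.
have S0 : 0 <= S.
  by apply: sumr_ge0 => t _; case/andP: (eta_bound t) => /ltW.
have step := gradient_step_bound (theta T) z (eta_bound T) f_convex f_smooth.
have decr : f (theta T.+1) <= f (theta T).
  rewrite theta_step.
  apply: le_trans (gradient_step_decrease _ (eta_bound T) f_smooth) _.
  rewrite gerBl mulr_ge0 ?sqr_ge0// divr_ge0//.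
  by case/andP: (eta_bound T) => /ltW.
rewrite -theta_step in step.
have := ler_wpM2l S0 decr; lra.
Qed.

End GradientDescent.

Theorem theorem1 (R : realType) (d : nat) (f : 'rV[R]_d -> R) (L : R)
    (theta : nat -> 'rV[R]_d) (eta : nat -> R)
    (L_gt0 : 0 < L)
    (f_convex : convex_function [set: convex_lmodType 'rV[R]_d] f)
    (f_diff : forall x : 'rV[R]_d, differentiable f x)
    (f_smooth : smooth L f)
    (eta_bound : forall t : nat, 0 < eta t <= 1 / L)
    (theta_step : forall t : nat,
       theta t.+1 = theta t - eta t *: gradient f (theta t)) :
  forall (z : 'rV[R]_d) (T : nat), (1 <= T)%N ->
    f (theta T) - f z <=
      1 / (2 * \sum_(0 <= t < T) eta t) *
        (norm2 (theta 0%N - z) ^+ 2 - norm2 (theta T - z) ^+ 2)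
    /\
    (forall eta0 : R, (forall t : nat, eta t = eta0) ->
       f (theta T) - f z <=
         1 / (2 * eta0 * T%:R) *
           (norm2 (theta 0%N - z) ^+ 2 - norm2 (theta T - z) ^+ 2)).
Proof.
move=> z T T1.
have bound := gradient_descent_telescope
  L_gt0 f_convex f_smooth eta_bound theta_step z T.
have S0 : 0 < \sum_(0 <= t < T) eta t.
  case: T T1 {bound} => // T _; rewrite big_nat_recl//=.
  apply: ltr_wpDr; last by case/andP: (eta_bound 0%N).
  by apply: sumr_ge0 => t _; case/andP: (eta_bound t.+1) => /ltW.
have goal : f (theta T) - f z <= 1 / (2 * \sum_(0 <= t < T) eta t) *
    (norm2 (theta 0%N - z) ^+ 2 - norm2 (theta T - z) ^+ 2).
  by rewrite mul1r ler_pdivlMl// mulr_gt0.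
split=> // eta0 etaE; suff <- : 2 * \sum_(0 <= t < T) eta t = 2 * eta0 * T%:R.
  exact: goal.
under eq_bigr do rewrite etaE.
by rewrite sumr_const_nat subn0 -mulrA mulr_natr.
Qed.
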